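(* Let $(X,\le)$ be a finite poset, $K$ a field, and $\mathcal{J}=J(I(X,K))$ the Jacobson radical of the incidence algebra $I(X,K)$, with product $\cdot$. Proper totally compatible structures on $(\mathcal{J},\cdot)$ are exactly the bilinear products $*$ on $\mathcal{J}$ of the form $$e_{xy}*e_{uv}=\sigma(x,v)\,\delta_{yu}\,e_{xv}+e_{xy}\bullet e_{uv}\qquad (x<y,\ u<v),$$ where $\sigma:X^2_<\to K$ is constant on chains and $\bullet$ is an annihilator-valued structure on $(\mathcal{J},\cdot)$.
   Context: All products are $K$-bilinear. The incidence algebra $I(X,K)$ is the associative $K$-algebra with basis $\{e_{xy}: x,y\in X,\ x\le y\}$ and multiplication $e_{xy}\cdot e_{uv}=\delta_{yu}e_{xv}$ ($\delta$ is the Kronecker delta). Its Jacobson radical is $\mathcal{J}=\mathrm{span}_K\{e_{xy}: x<y\}$. The term $\sigma(x,v)\delta_{yu}e_{xv}$ is understood as $0$ when $y\ne u$. Two products $\cdot_1,\cdot_2$ on a vector space $V$ are totally compatible if $(a\cdot_1 b)\cdot_2 c=(a\cdot_2 b)\cdot_1 c=a\cdot_1(b\cdot_2 c)=a\cdot_2(b\cdot_1 c)$ for all $a,b,c\in V$. A totally compatible structure on an associative algebra $(A,\cdot)$ is an associative bilinear product $*$ on $A$ such that $\cdot$ and $*$ are totally compatible. The centroid $\Gamma(A)$ is the space of linear maps $\varphi:A\to A$ with $\varphi(a\cdot b)=a\cdot\varphi(b)=\varphi(a)\cdot b$ for all $a,b\in A$; for $\varphi\in\Gamma(A)$ let $a*_\varphi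 b=\varphi(a\cdot b)$. A bilinear product $\bullet$ on $A$ is annihilator-valued (with respect to $\cdot$) if $(A\cdot A)\bullet A=(A\bullet A)\cdot A=A\cdot(A\bullet A)=A\bullet(A\cdot A)=\{0\}$, where a product of subspaces is the span of all products of elements. An annihilator-valued structure on $(A,\cdot)$ is an associative annihilator-valued bilinear product on $A$. A totally compatible structure on $(A,\cdot)$ is proper if it is of the form $*_\varphi+\bullet$ with $\varphi\in\Gamma(A)$ and $\bullet$ an annihilator-valued structure on $(A,\cdot)$. $X^2_<=\{(x,y)\in X^2: x<y\}$. A chain in $X$ is a nonempty subset of pairwise comparable elements. A map $\sigma:X^2_<\to K$ is constant on chains if $\sigma(x,y)=\sigma(u,v)$ whenever $x<y$ and $u<v$ belong to a same chain in $X$. *)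

(* Defs.v *)
From HB Require Import structures.
From mathcomp Require Import all_boot all_order all_algebra.

Set Implicit Arguments.
Unset Strict Implicit.
Unset Printing Implicit Defensive.

Import Order.Theory GRing.Theory.
Local Open Scope ring_scope.

Section Products.
Variables (K : fieldType) (A : lmodType K).
Implicit Types (m dot star bul : A -> A -> A).

Definition bilinear_product m : Prop := bilinear_for *:%R *:%R m.

Definition totally_compatible m1 m2 : Prop :=
  forall a b c, [/\ m2 (m1 a b) c = m1 (m2 a b) c,
                    m1 (m2 a b) c = m1 a (m2 b c) &
                    m1 a (m2 b c) = m2 a (m1 b c)].

Definition totally_compatible_structure dot star : Prop :=
  [/\ bilinear_product star, associative star & totally_compatible dot star].

Definition in_centroid dot (phi : {linear A -> A}) : Prop :=
  forall a b, phi (dot a b) = dot a (phi b) /\ phi (dot a b) = dot (phi a) b.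

(* The linear span of the products m u v with u in U and v in V. *)
Definition subspace_product m (U V : A -> Prop) : A -> Prop :=
  fun w => exists (n : nat) (c : 'I_n -> K) (u v : 'I_n -> A),
    (forall i, U (u i) /\ V (v i)) /\ w = \sum_(i < n) c i *: m (u i) (v i).

Definition is_zero_subspace (U : A -> Prop) : Prop := forall w, U w <-> w = 0.

Definition annihilator_valued dot bul : Prop :=
  let T := fun _ : A => True in
  [/\ is_zero_subspace (subspace_product bul (subspace_product dot T T) T),
      is_zero_subspace (subspace_product dot (subspace_product bul T T) T),
      is_zero_subspace (subspace_product dot T (subspace_product bul T T)) &
      is_zero_subspace (subspace_product bul T (subspace_product dot T T))].

Definition annihilator_valued_structure dot bul : Prop :=
  [/\ bilinear_product bul, associative bul & annihilator_valued dot bul].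

Definition proper_structure dot star : Prop :=
  totally_compatible_structure dot star /\
  exists (phi : {linear A -> A}) (bul : A -> A -> A),
    [/\ in_centroid dot phi, annihilator_valued_structure dot bul &
        forall a b, star a b = phi (dot a b) + bul a b].
End Products.

(* The Jacobson radical of a unital ring: the intersection of its maximal
   left ideals. *)
Section Jacobson.
Variable R : pzRingType.

Definition left_ideal (M : R -> Prop) : Prop :=
  [/\ M 0, forall a b, M a -> M b -> M (a + b) & forall r a, M a -> M (r * a)].

Definition maximal_left_ideal (M : R -> Prop) : Prop :=
  [/\ left_ideal M, ~ M 1 &
      forall N : R -> Prop, left_ideal N -> ~ N 1 ->
        (forall a, M a -> N a) -> forall a, N a -> M a].

Definition jacobson_radical (a : R) : Prop :=
  forall M, maximal_left_ideal M -> M a.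
End Jacobson.

Section Incidence.
Variables (d : Order.disp_t) (X : finPOrderType d) (K : fieldType).

Definition interval_pair : predArgType := {p : X * X | (p.1 <= p.2)%O}.
Definition strict_pair : predArgType := {p : X * X | (p.1 < p.2)%O}.

(* The value at (x, y) of a function defined on a set of pairs, extended by 0
   to all pairs. *)
Definition ext0 (P : pred (X * X)) (f : {p | P p} -> K) (x y : X) : K :=
  if insub (x, y) is Some p then f p else 0.

(* Elements of I(X, K) are given by their coordinates on the e_xy. *)
Definition incidence : Type := {ffun interval_pair -> K^o}.
HB.instance Definition _ := Vector.on incidence.

Implicit Types f g h : incidence.

Definition coef f (x y : X) : K := ext0 f x y.

Definition inc_mul f g : incidence :=
  [ffun p : interval_pair => \sum_y coef f (val p).1 y * coef g y (val p).2].

Definition inc_one : incidence := [ffun p : interval_pair => ((val p).1 == (val p).2)%:R].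

(* e_xy, which is 0 unless x <= y *)
Definition inc_basis (x y : X) : incidence :=
  [ffun p : interval_pair => (val p == (x, y))%:R].

Lemma coefE f (p : interval_pair) : coef f (val p).1 (val p).2 = f p.
Proof.
rewrite /coef /ext0 -surjective_pairing; case: insubP => [q _ /val_inj -> //|].
by rewrite (valP p).
Qed.

Lemma coef_nle f x y : ~~ (x <= y)%O -> coef f x y = 0.
Proof. by move=> nxy; rewrite /coef /ext0 insubN. Qed.

Lemma incP f g : (forall x y, coef f x y = coef g x y) -> f = g.
Proof. by move=> efg; apply/ffunP=> p; rewrite -!coefE efg. Qed.

Lemma coef_ffun (F : X -> X -> K) x y : (x <= y)%O ->
  coef [ffun p : interval_pair => F (val p).1 (val p).2] x y = F x y.
Proof.
move=> xy; rewrite /coef /ext0; case: insubP => [q _ vq|]; last by rewrite xy.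
by rewrite ffunE vq.
Qed.

Lemma coef0 x y : coef 0 x y = 0.
Proof. by rewrite /coef /ext0; case: insubP => // q _ _; rewrite ffunE. Qed.

Lemma coefD f g x y : coef (f + g) x y = coef f x y + coef g x y.
Proof.
by rewrite /coef /ext0; case: insubP => [q _ _|_]; rewrite ?ffunE ?addr0.
Qed.

Lemma coefZ c f x y : coef (c *: f) x y = c * coef f x y.
Proof.
by rewrite /coef /ext0; case: insubP => [q _ _|_]; rewrite ?ffunE ?mulr0.
Qed.

Lemma coef_mul f g x y : coef (inc_mul f g) x y = \sum_z coef f x z * coef g z y.
Proof.
have [xy|nxy] := boolP (x <= y)%O.
  by rewrite (coef_ffun (fun x y => \sum_z coef f x z * coef g z y)).
rewrite coef_nle // big1 // => z _.
have [xz|nxz] := boolP (x <= z)%O; last by rewrite coef_nle ?mul0r.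
have [zy|nzy] := boolP (z <= y)%O; last by rewrite (coef_nle g) ?mulr0.
by rewrite (le_trans xz zy) in nxy.
Qed.

Lemma coef_one x y : coef inc_one x y = (x == y)%:R.
Proof.
have [xy|nxy] := boolP (x <= y)%O.
  by rewrite (coef_ffun (fun x y => (x == y)%:R)).
by rewrite coef_nle //; case: eqP nxy => // ->; rewrite lexx.
Qed.

Lemma coef_basis x y u v :
  coef (inc_basis x y) u v = ((x <= y)%O && ((u, v) == (x, y)))%:R.
Proof.
have [uv|nuv] := boolP (u <= v)%O.
  rewrite /coef /ext0; case: insubP => [q _ vq|]; last by rewrite uv.
  rewrite ffunE vq; case: eqP => [[eu ev]|]; last by rewrite andbF.
  by rewrite -eu -ev uv.
by rewrite coef_nle //; case: eqP => [[<- <-]|]; rewrite ?andbF // (negPf nuv).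
Qed.

Lemma inc_mulA : associative inc_mul.
Proof.
move=> f g h; apply: incP => x y; rewrite !coef_mul.
under eq_bigr do rewrite coef_mul mulr_sumr.
under [RHS]eq_bigr do rewrite coef_mul mulr_suml.
rewrite exchange_big; apply: eq_bigr => z _; apply: eq_bigr => t _.
by rewrite mulrA.
Qed.

Lemma inc_mul1l : left_id inc_one inc_mul.
Proof.
move=> f; apply: incP => x y; rewrite coef_mul (bigD1 x) //= coef_one eqxx mul1r.
by rewrite big1 ?addr0 // => z zx; rewrite coef_one eq_sym (negPf zx) mul0r.
Qed.

Lemma inc_mul1r : right_id inc_one inc_mul.
Proof.
move=> f; apply: incP => x y; rewrite coef_mul (bigD1 y) //= coef_one eqxx mulr1.
by rewrite big1 ?addr0 // => z zx; rewrite coef_one (negPf zx) mulr0.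
Qed.

Lemma inc_mulDl : left_distributive inc_mul +%R.
Proof.
move=> f g h; apply: incP => x y; rewrite coefD !coef_mul -big_split /=.
by apply: eq_bigr => z _; rewrite coefD mulrDl.
Qed.

Lemma inc_mulDr : right_distributive inc_mul +%R.
Proof.
move=> f g h; apply: incP => x y; rewrite coefD !coef_mul -big_split /=.
by apply: eq_bigr => z _; rewrite coefD mulrDr.
Qed.

HB.instance Definition _ := GRing.Zmodule_isPzRing.Build incidence
  inc_mulA inc_mul1l inc_mul1r inc_mulDl inc_mulDr.

Lemma inc_scalerAl c f g : c *: (f * g) = (c *: f) * g.
Proof.
apply: incP => x y; rewrite coefZ !coef_mul mulr_sumr.
by apply: eq_bigr => z _; rewrite coefZ mulrA.
Qed.

Lemma inc_scalerAr c f g : c *: (f * g) = f * (c *: g).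
Proof.
apply: incP => x y; rewrite coefZ !coef_mul mulr_sumr.
by apply: eq_bigr => z _; rewrite coefZ mulrCA.
Qed.

Lemma inc_basisM x y u v : (x <= y)%O -> (u <= v)%O ->
  inc_basis x y * inc_basis u v = (y == u)%:R *: inc_basis x v.
Proof.
move=> xy uv; apply: incP => s t; rewrite coefZ coef_mul.
rewrite (bigD1 y) //= big1 => [|z zy]; last first.
  by rewrite coef_basis xpair_eqE (negPf zy) !andbF mul0r.
rewrite !coef_basis !xpair_eqE xy uv eqxx andbT addr0 -!natrM !mulnb /=.
congr (_%:R : K); have [yu|//] := eqVneq y u; last by rewrite andbF.
by rewrite -yu in uv *; rewrite (le_trans xy uv).
Qed.

Definition inc_rad : {vspace incidence} :=
  <<[seq inc_basis p.1 p.2 | p : X * X in [pred p | (p.1 < p.2)%O]]>>%VS.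

Lemma coef_sum (I : finType) (F : I -> incidence) x y :
  coef (\sum_i F i) x y = \sum_i coef (F i) x y.
Proof.
by apply: (big_morph (fun h => coef h x y)) => [g h|]; rewrite ?coefD ?coef0.
Qed.

Lemma inc_basis_sum f : f = \sum_(p : X * X) coef f p.1 p.2 *: inc_basis p.1 p.2.
Proof.
apply: incP => x y.
rewrite coef_sum (bigD1 (x, y)) //= big1 => [|p pxy]; last first.
  by rewrite coefZ coef_basis -surjective_pairing eq_sym (negPf pxy) andbF mulr0.
rewrite addr0 coefZ coef_basis eqxx andbT.
by have [_|nxy] := boolP (x <= y)%O; rewrite ?mulr1 // coef_nle ?mul0r.
Qed.

Lemma mem_inc_rad f : (f \in inc_rad) = [forall x, coef f x x == 0].
Proof.
apply/idP/forallP => [fJ x|f0].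
  rewrite (coord_span fJ) (coef_sum _ x x) big1 // => i _; rewrite coefZ.
  have /imageP [[u v] /= uv ->] : (in_tuple [seq inc_basis p.1 p.2 |
      p : X * X in [pred p | (p.1 < p.2)%O]])`_i \in
      [seq inc_basis p.1 p.2 | p : X * X in [pred p | (p.1 < p.2)%O]].
    by rewrite mem_nth // size_map -cardE ltn_ord.
  rewrite coef_basis xpair_eqE; have [xu|] := eqVneq x u; last first.
    by rewrite andbF mulr0n mulr0.
  by rewrite xu (lt_eqF uv) !andbF mulr0n mulr0.
rewrite (inc_basis_sum f) memv_suml // => -[x y] _ /=.
have [xy|] := boolP (x < y)%O.
  by rewrite memvZ // memv_span //; apply/imageP; exists (x, y).
rewrite lt_neqAle negb_and negbK => /orP[/eqP <-|nxy].
  by rewrite (eqP (f0 x)) scale0r mem0v.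
by rewrite coef_nle // scale0r mem0v.
Qed.

Lemma coef_mul_diag f g x : coef (f * g) x x = coef f x x * coef g x x.
Proof.
rewrite coef_mul (bigD1 x) //= big1 ?addr0 // => z zx.
have [xz|] := boolP (x <= z)%O; last by move/coef_nle->; rewrite mul0r.
by rewrite (coef_nle g) ?mulr0 //; apply: contra zx => zx; rewrite eq_le zx.
Qed.

Lemma inc_radMl f g : g \in inc_rad -> f * g \in inc_rad.
Proof.
rewrite !mem_inc_rad => /forallP g0; apply/forallP => x.
by rewrite coef_mul_diag (eqP (g0 x)) mulr0.
Qed.

Lemma inc_rad_nilp f : f \in inc_rad -> f ^+ #|X|.+1 = 0.
Proof.
rewrite mem_inc_rad => /forallP f0.
pose h x := #|[set z : X | (z < x)%O]|.
have hlt x y : (x < y)%O -> (h x < h y)%N.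
  move=> xy; apply: proper_card; apply/properP; split.
    by apply/subsetP => z; rewrite !inE => /lt_trans->.
  by exists x; rewrite !inE ?ltxx.
have fk k x y : coef (f ^+ k) x y != 0 -> (h x + k <= h y)%N.
  elim: k x => [|k IH] x.
    by rewrite coef_one addn0; have [-> //|_] := eqVneq x y; rewrite eqxx.
  rewrite exprS coef_mul; apply: contraNT; rewrite -ltnNge => hy.
  apply/eqP/big1 => z _; have [xz|] := boolP (x < z)%O.
    have [->|/IH hz] := eqVneq (coef (f ^+ k) z y) 0; first by rewrite mulr0.
    by have := leq_ltn_trans hz hy; rewrite addnS ltnS leq_add2r leqNgt (hlt _ _ xz).
  rewrite lt_neqAle negb_and negbK => /orP[/eqP <-|/coef_nle->]; last by rewrite mul0r.
  by rewrite (eqP (f0 x)) mul0r.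
apply: incP => x y; rewrite coef0; apply/eqP; apply/negPn/negP => /fk.
by rewrite leqNgt addnS ltnS (leq_trans (max_card _)) ?leq_addl.
Qed.

(* inc_rad is the Jacobson radical of I(X, K). *)
Lemma inc_rad_jacobson f : f \in inc_rad <-> jacobson_radical f.
Proof.
split=> [fJ M [[M0 MD MM] M1 Mmax] | fJ].
  pose N g := exists m r, M m /\ g = m + r * f.
  apply: (Mmax N); last by exists 0, 1; rewrite mul1r add0r.
  - split.
    + by exists 0, 0; rewrite mul0r addr0.
    + move=> _ _ [m [r [Mm ->]]] [m' [r' [Mm' ->]]].
      by exists (m + m'), (r + r'); rewrite mulrDl addrACA; split=> //; apply: MD.
    + move=> s _ [m [r [Mm ->]]]; exists (s * m), (s * r).
      by rewrite mulrDr mulrA; split=> //; apply: MM.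
  - move=> [m [r [Mm e1]]]; apply: M1.
    have Mk k : M (1 - (r * f) ^+ k).
      elim: k => [|k IH]; first by rewrite expr0 subrr.
      have -> : 1 - (r * f) ^+ k.+1 = (1 - (r * f) ^+ k) + (r * f) ^+ k * m.
        have -> : m = 1 - r * f by rewrite e1 addrK.
        by rewrite mulrBr mulr1 -exprSr addrA subrK.
      by apply: MD => //; apply: MM.
    by have := Mk #|X|.+1; rewrite (inc_rad_nilp (inc_radMl r fJ)) subr0.
  - by move=> a Ma; exists a, 0; rewrite mul0r addr0.
rewrite mem_inc_rad; apply/forallP => x; apply/eqP.
apply: (fJ (fun g => coef g x x = 0)); split; first split.
- exact: coef0.
- by move=> a b a0 b0; rewrite coefD a0 b0 addr0.
- by move=> r a a0; rewrite coef_mul_diag a0 mulr0.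
- by rewrite coef_one eqxx; apply/eqP; exact: oner_neq0.
move=> N [N0 ND NM] N1 MN a Na; apply/eqP/negPn/negP => a0; apply: N1.
pose c := (coef a x x)^-1.
rewrite -[1](subrK (c *: a)); apply: ND.
  apply: MN; rewrite -scaleN1r coefD coefZ coefZ coef_one eqxx.
  by rewrite mulVf // mulr1 subrr.
by rewrite -[a]mul1r inc_scalerAl; apply: NM.
Qed.

(* The algebra J = J(I(X, K)), with the product of I(X, K). *)
Definition J : Type := subvs_of inc_rad.
HB.instance Definition _ := Vector.on J.

Definition J_mul (a b : J) : J := vsproj inc_rad (vsval a * vsval b).

Lemma J_mulE a b : vsval (J_mul a b) = vsval a * vsval b.
Proof. by rewrite vsprojK // inc_radMl // subvsP. Qed.

(* e_xy as an element of J, for x < y *)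
Definition J_basis (x y : X) : J := vsproj inc_rad (inc_basis x y).

Lemma J_basisE x y : (x < y)%O -> vsval (J_basis x y) = inc_basis x y.
Proof.
by move=> xy; rewrite vsprojK // memv_span //; apply/imageP; exists (x, y).
Qed.

Lemma J_mulA : associative J_mul.
Proof. by move=> a b c; apply: val_inj; rewrite /= !J_mulE mulrA. Qed.

Lemma J_mul_bilinear : bilinear_product J_mul.
Proof.
split=> [b k a1 a2|a k b1 b2]; apply: val_inj; rewrite /= !(linearP, J_mulE) /=.
  by rewrite mulrDl inc_scalerAl.
by rewrite mulrDr inc_scalerAr.
Qed.

Definition is_chain (C : {set X}) : Prop :=
  C != set0 /\ {in C &, forall x y, (x >=< y)%O}.

Definition constant_on_chains (sigma : strict_pair -> K) : Prop :=
  forall C : {set X}, is_chain C -> forall p q : strict_pair,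
    (val p).1 \in C -> (val p).2 \in C -> (val q).1 \in C -> (val q).2 \in C ->
    sigma p = sigma q.

End Incidence.

(* Main.v *)
(* The centroid identity phi(e_xy e_yv) = e_xy phi(e_yv) = phi(e_xy) e_yv places
   phi(e_xv) both in row x and in column v as soon as x < y < v, so that
   phi(e_xv) = sigma(x, v) e_xv, where sigma(x, y) is the coefficient of phi(e_xy)
   at (x, y); it also gives sigma(x, y) = sigma(x, v) = sigma(y, v), which is
   constancy on chains.  Conversely, a map sigma constant on chains acts on J
   diagonally by an element of the centroid. *)
Require Import Defs.
From HB Require Import structures.
From mathcomp Require Import all_boot all_order all_algebra.
Import Order.Theory GRing.Theory.
Local Open Scope ring_scope.

Set Implicit Arguments.
Unset Strict Implicit.
Unset Printing Implicit Defensive.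

(** * Bilinear products and proper structures over an arbitrary algebra *)

Section ProperStructures.
Context {K : fieldType} {A : lmodType K}.
Implicit Types dot bul m star : A -> A -> A.

Lemma bilinear_productD m : bilinear_product m ->
  left_distributive m +%R * right_distributive m +%R.
Proof.
case=> ml mr; split=> [a b c | a b c].
  (* Bilinearity is given on combinations [k *: a + b]: the scalar 1 yields additivity. *)
  by have := ml c 1 a b; rewrite /= !scale1r.
by have := mr a 1 b c; rewrite /= !scale1r.
Qed.

Lemma bilinear_product0 m : bilinear_product m ->
  (forall a, m 0 a = 0) * (forall a, m a 0 = 0).
Proof.
move=> /bilinear_productD [mDl mDr]; split=> a.
  by apply: (addIr (m 0 a)); rewrite -mDl !add0r.
by apply: (addIr (m a 0)); rewrite -mDr !add0r.
Qed.

Lemma bilinear_productZ m : bilinear_product m ->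
  (forall k a b, m (k *: a) b = k *: m a b) *
  (forall k a b, m a (k *: b) = k *: m a b).
Proof.
move=> bm; have [m0l m0r] := bilinear_product0 bm; case: bm => ml mr.
split=> k a b.
  by have := ml b k a 0; rewrite /= !(addr0, m0l).
by have := mr a k b 0; rewrite /= !(addr0, m0r).
Qed.

Lemma bilinear_product_sum m (I : finType) (c d : I -> K) (u v : I -> A) :
  bilinear_product m ->
  m (\sum_i c i *: u i) (\sum_j d j *: v j) =
    \sum_i \sum_j (c i * d j) *: m (u i) (v j).
Proof.
move=> bm; have [mDl mDr] := bilinear_productD bm.
have [m0l m0r] := bilinear_product0 bm; have [mZl mZr] := bilinear_productZ bm.
rewrite (big_morph (m^~ _) (fun a b => mDl a b _) (m0l _)).
apply: eq_bigr => i _; rewrite mZl (big_morph (m _) (mDr _) (m0r _)) scaler_sumr.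
by apply: eq_bigr => j _; rewrite mZr scalerA.
Qed.

Lemma mem_subspace_product m (U V : A -> Prop) a b :
  U a -> V b -> subspace_product m U V (m a b).
Proof.
move=> Ua Vb; exists 1%N, (fun=> 1), (fun=> a), (fun=> b); split=> //.
by rewrite big_ord1 scale1r.
Qed.

(** Each single product is a one-term element of the corresponding span, so the four vanishing
    subspaces yield elementwise identities. *)
Lemma annihilator_valued_eq0 dot bul : annihilator_valued dot bul ->
  forall a b c, [/\ bul (dot a b) c = 0, dot (bul a b) c = 0,
                    dot a (bul b c) = 0 & bul a (dot b c) = 0].
Proof.
move=> [h1 h2 h3 h4] a b c.
by split; [apply/h1 | apply/h2 | apply/h3 | apply/h4];
  do 2?[apply: mem_subspace_product => //].
Qed.

(** Total compatibility and associativity come for free: every mixed product of a, b, c under [dot]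
    and [star] reduces to phi(abc), while either bracketing under [star] gives phi(phi(abc)) plus
    the triple [bul] product. *)
Lemma proper_structure_centroid dot star bul (phi : {linear A -> A}) :
  bilinear_product dot -> associative dot -> in_centroid dot phi ->
  annihilator_valued_structure dot bul ->
  (forall a b, star a b = phi (dot a b) + bul a b) ->
  proper_structure dot star.
Proof.
move=> bdot dotA cphi sbul starE; split; last by exists phi, bul.
have [bbul bulA /annihilator_valued_eq0 ann] := sbul.
have [dotDl dotDr] := bilinear_productD bdot.
have [bulDl bulDr] := bilinear_productD bbul.
have phil a b : dot (phi a) b = phi (dot a b) by have [_ ->] := cphi a b.
have phir a b : dot a (phi b) = phi (dot a b) by have [-> _] := cphi a b.
have ann1 a b c : bul (dot a b) c = 0 by have [] := ann a b c.
have ann2 a b c : dot (bul a b) c = 0 by have [] := ann a b c.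
have ann3 a b c : dot a (bul b c) = 0 by have [] := ann a b c.
have ann4 a b c : bul a (dot b c) = 0 by have [] := ann a b c.
(* By centrality phi(ab) = a phi(b) is again a [dot] product, so [bul] kills it on either side. *)
have annp1 a b c : bul (phi (dot a b)) c = 0 by rewrite -phir ann1.
have annp4 a b c : bul a (phi (dot b c)) = 0 by rewrite -phir ann4.
split.
- have [bdl bdr] := bdot; have [bbl bbr] := bbul.
  split=> [b k a1 a2 | a k b1 b2]; rewrite /= !starE.
    by rewrite bdl bbl linearP scalerDr addrACA.
  by rewrite bdr bbr linearP scalerDr addrACA.
- move=> a b c; rewrite !starE bulDl bulDr dotDl dotDr annp1 annp4 ann2 ann3.
  by rewrite !addr0 !add0r phil phir dotA bulA.
- move=> a b c; rewrite !starE dotDl dotDr ann1 ann2 ann3 ann4 !addr0.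
  by rewrite phil phir dotA.
Qed.
End ProperStructures.

(** * Coordinates and basis of the radical J *)

Section IncidenceRadical.
Context {d : Order.disp_t} {X : finPOrderType d} {K : fieldType}.
Implicit Types (a b : J X K) (x y z u v : X) (sigma : strict_pair X -> K).

Definition Jcoef a (x y : X) : K := coef (vsval a) x y.

Lemma JcoefP a b : (forall x y, Jcoef a x y = Jcoef b x y) -> a = b.
Proof. by move=> eab; apply: val_inj; apply: incP. Qed.

(** Membership in the radical forces a zero diagonal; outside the order, coordinates already vanish
    in the incidence algebra. *)
Lemma Jcoef_nlt a x y : ~~ (x < y)%O -> Jcoef a x y = 0.
Proof.
rewrite lt_neqAle negb_and negbK => /orP[/eqP <-|]; last exact: coef_nle.
by apply/eqP; move: x; apply/forallP; rewrite -mem_inc_rad subvsP.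
Qed.

Lemma JcoefM a b x y :
  Jcoef (J_mul a b) x y = \sum_z Jcoef a x z * Jcoef b z y.
Proof. by rewrite /Jcoef J_mulE coef_mul. Qed.

Lemma Jcoef_basis x y u v : (x < y)%O ->
  Jcoef (J_basis K x y) u v = ((u, v) == (x, y))%:R.
Proof. by move=> xy; rewrite /Jcoef J_basisE // coef_basis (ltW xy). Qed.

Lemma JcoefD a b x y : Jcoef (a + b) x y = Jcoef a x y + Jcoef b x y.
Proof. by rewrite /Jcoef linearD /= Defs.coefD. Qed.

Lemma JcoefZ k a x y : Jcoef (k *: a) x y = k * Jcoef a x y.
Proof. by rewrite /Jcoef linearZ /= Defs.coefZ. Qed.

Lemma Jcoef_sum (I : finType) (F : I -> J X K) x y :
  Jcoef (\sum_i F i) x y = \sum_i Jcoef (F i) x y.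
Proof. by rewrite /Jcoef linear_sum Defs.coef_sum. Qed.

Lemma J_basisM x y u v : (x < y)%O -> (u < v)%O ->
  J_mul (J_basis K x y) (J_basis K u v) = (y == u)%:R *: J_basis K x v.
Proof.
move=> xy uv; apply: val_inj.
rewrite /= J_mulE (J_basisE K xy) (J_basisE K uv) inc_basisM ?ltW //.
have [yu|_] := eqVneq y u; last by rewrite !scale0r.
by rewrite J_basisE // (lt_trans xy) // yu.
Qed.

Lemma Jcoef_basisMl x y a u v : (x < y)%O ->
  Jcoef (J_mul (J_basis K x y) a) u v = (u == x)%:R * Jcoef a y v.
Proof.
move=> xy; rewrite JcoefM (bigD1 y) //= big1 => [|z zy].
  by rewrite Jcoef_basis // xpair_eqE eqxx andbT addr0.
by rewrite Jcoef_basis // xpair_eqE (negPf zy) andbF mul0r.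
Qed.

Lemma Jcoef_basisMr x y a u v : (x < y)%O ->
  Jcoef (J_mul a (J_basis K x y)) u v = Jcoef a u x * (v == y)%:R.
Proof.
move=> xy; rewrite JcoefM (bigD1 x) //= big1 => [|z zx].
  by rewrite Jcoef_basis // xpair_eqE eqxx addr0.
by rewrite Jcoef_basis // xpair_eqE (negPf zx) mulr0.
Qed.

Lemma J_basis_sum a :
  a = \sum_(p : strict_pair X)
    Jcoef a (val p).1 (val p).2 *: J_basis K (val p).1 (val p).2.
Proof.
apply: JcoefP => x y; rewrite Jcoef_sum.
have [xy|nxy] := boolP (x < y)%O; last first.
  by rewrite Jcoef_nlt // big1 // => p _; rewrite Jcoef_nlt.
rewrite (bigD1 (exist _ (x, y) xy)) //= big1 => [|p npxy].
  by rewrite JcoefZ Jcoef_basis // eqxx mulr1 addr0.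
rewrite JcoefZ Jcoef_basis; last exact: (valP p).
rewrite -surjective_pairing eq_sym; move: npxy; rewrite -val_eqE /= => /negPf->.
by rewrite mulr0.
Qed.

Lemma eq_bilinear_J (m1 m2 : J X K -> J X K -> J X K) :
  bilinear_product m1 -> bilinear_product m2 ->
  (forall x y u v, (x < y)%O -> (u < v)%O ->
     m1 (J_basis K x y) (J_basis K u v) = m2 (J_basis K x y) (J_basis K u v)) ->
  m1 =2 m2.
Proof.
move=> b1 b2 e12 a b; rewrite (J_basis_sum a) (J_basis_sum b).
rewrite !bilinear_product_sum //; apply: eq_bigr => p _; apply: eq_bigr => q _.
by rewrite e12 ?(valP p, valP q).
Qed.

Lemma ext0_strict sigma (p : strict_pair X) :
  ext0 sigma (val p).1 (val p).2 = sigma p.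
Proof. by rewrite /ext0 -surjective_pairing valK. Qed.

(** * From a map constant on chains to a centroid element *)

Section Diagonal.
Variable sigma : strict_pair X -> K.

(** The function under [vsproj] inherits the zero diagonal of [a], hence lies in J and is left
    unchanged by the projection. *)
Definition diag_fun a : J X K :=
  vsproj _ [ffun p : interval_pair X =>
    ext0 sigma (val p).1 (val p).2 * Jcoef a (val p).1 (val p).2 : K^o].

Lemma Jcoef_diag a x y :
  Jcoef (diag_fun a) x y = ext0 sigma x y * Jcoef a x y.
Proof.
have cE u v : coef [ffun p : interval_pair X =>
    ext0 sigma (val p).1 (val p).2 * Jcoef a (val p).1 (val p).2 : K^o] u v =
    ext0 sigma u v * Jcoef a u v.
  have [uv|nuv] := boolP (u <= v)%O.
    by rewrite (coef_ffun (fun u v => ext0 sigma u v * Jcoef a u v)).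
  by rewrite coef_nle // /Jcoef coef_nle ?mulr0.
rewrite {1}/Jcoef vsprojK // mem_inc_rad; apply/forallP => z.
by rewrite cE Jcoef_nlt ?ltxx // mulr0.
Qed.

Lemma diag_fun_linear : linear diag_fun.
Proof.
move=> k a b; apply: JcoefP => x y; rewrite Jcoef_diag.
by rewrite !JcoefD !JcoefZ !Jcoef_diag mulrDr mulrCA.
Qed.

HB.instance Definition _ :=
  GRing.isLinear.Build K (J X K) (J X K) *:%R diag_fun diag_fun_linear.

Hypothesis sigma_chain : constant_on_chains sigma.

(** All three pairs lie in the chain {x, y, z}. *)
Lemma constant_on_chains_lt x y z : (x < y)%O -> (y < z)%O ->
  (ext0 sigma x y = ext0 sigma x z) * (ext0 sigma y z = ext0 sigma x z).
Proof.
move=> xy yz; have xz := lt_trans xy yz.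
have C_chain : is_chain [set x; y; z].
  split; first by apply/set0Pn; exists x; rewrite !inE eqxx.
  move=> u v; rewrite !inE -!orbA => /or3P[]/eqP-> /or3P[]/eqP->;
    by rewrite /Order.comparable ?lexx ?(ltW xy) ?(ltW yz) ?(ltW xz) ?orbT.
pose p : strict_pair X := exist _ (x, y) xy.
pose q : strict_pair X := exist _ (y, z) yz.
pose r : strict_pair X := exist _ (x, z) xz.
rewrite (ext0_strict sigma p) (ext0_strict sigma q) (ext0_strict sigma r).
by split; apply: (sigma_chain C_chain); rewrite !inE eqxx ?orbT.
Qed.

(** In the coordinate of ab at (x, y) only the z with x < z < y contribute, and there [sigma] takes
    the same value at (x, z), (z, y) and (x, y). *)
Lemma diag_in_centroid : in_centroid (@J_mul d X K) diag_fun.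
Proof.
move=> a b; split; apply: JcoefP => x y;
  rewrite Jcoef_diag !JcoefM mulr_sumr; apply: eq_bigr => z _;
  rewrite Jcoef_diag;
  have [xz|nxz] := boolP (x < z)%O; [|by rewrite (Jcoef_nlt a) ?(mul0r, mulr0)
    | |by rewrite (Jcoef_nlt a) ?(mul0r, mulr0)];
  have [zy|nzy] := boolP (z < y)%O; [|by rewrite (Jcoef_nlt b) ?mulr0
    | |by rewrite (Jcoef_nlt b) ?mulr0];
  have [e1 e2] := constant_on_chains_lt xz zy.
  by rewrite e2 mulrCA.
by rewrite e1 mulrA.
Qed.
End Diagonal.

(** * From a centroid element to a map constant on chains *)

Section Centroid.
Variable phi : {linear J X K -> J X K}.
Hypothesis phi_centroid : in_centroid (@J_mul d X K) phi.

(** If y covers x, then phi(e_xy) need not be a multiple of e_xy; only its own coordinate is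
    recorded. *)
Definition centroid_coef (x y : X) : K := Jcoef (phi (J_basis K x y)) x y.

Lemma centroid_basis_mid x y z : (x < y)%O -> (y < z)%O ->
  [/\ phi (J_basis K x z) = centroid_coef x z *: J_basis K x z,
      centroid_coef x y = centroid_coef x z &
      centroid_coef y z = centroid_coef x z].
Proof.
move=> xy yz; have xz := lt_trans xy yz.
have [el er] := phi_centroid (J_basis K x y) (J_basis K y z).
move: el er; rewrite J_basisM // eqxx scale1r => el er.
have cxz : phi (J_basis K x z) = centroid_coef x z *: J_basis K x z.
  apply: JcoefP => u v; rewrite JcoefZ Jcoef_basis // xpair_eqE.
  (* [el] confines phi(e_xz) to row x, and [er] confines it to column z. *)
  have [->|nux] := eqVneq u x; last by rewrite el Jcoef_basisMl // (negPf nux) mul0r mulr0.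
  have [->|nvz] := eqVneq v z; first by rewrite mulr1.
  by rewrite er Jcoef_basisMr // (negPf nvz) !mulr0.
(* The coordinate at (x, z) is read off from [er], then from [el]. *)
split=> //; rewrite {2}/centroid_coef.
  by rewrite er Jcoef_basisMr // eqxx mulr1.
by rewrite el Jcoef_basisMl // eqxx mul1r.
Qed.

Lemma eq_centroid_coef_left x y u : (x < y)%O -> (u < y)%O -> (x <= u)%O ->
  centroid_coef x y = centroid_coef u y.
Proof.
move=> xy uy; rewrite le_eqVlt => /orP[/eqP-> //|xu].
by have [_ _ ->] := centroid_basis_mid xu uy.
Qed.

Lemma eq_centroid_coef_right x y v : (x < y)%O -> (y <= v)%O ->
  centroid_coef x y = centroid_coef x v.
Proof.
move=> xy; rewrite le_eqVlt => /orP[/eqP-> //|yv].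
by have [_ -> _] := centroid_basis_mid xy yv.
Qed.

(** In a chain, both intervals can be enlarged, one endpoint at a time, to the one from the smaller
    left endpoint to the larger right endpoint, without changing the coefficient. *)
Lemma centroid_coef_chain :
  constant_on_chains (fun p : strict_pair X => centroid_coef (val p).1 (val p).2).
Proof.
move=> C [_ Ccmp] [[x y] /= xy] [[u v] /= uv] /= xC yC uC vC.
(* Exchanging the two pairs only reverses the equality. *)
wlog xu : x y u v xy uv xC yC uC vC / (x <= u)%O.
  move=> W; case/orP: (Ccmp _ _ xC uC) => h; first exact: W.
  by apply/esym/W.
case/orP: (Ccmp _ _ yC vC) => h.
  by rewrite (eq_centroid_coef_right xy h) (@eq_centroid_coef_left _ _ u) // (lt_le_trans xy h).
by rewrite (eq_centroid_coef_right uv h) (@eq_centroid_coef_left _ _ u) // (lt_le_trans uv h).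
Qed.
End Centroid.
End IncidenceRadical.

(** * Equivalence of the two descriptions *)

Theorem corollary4p8 (d : Order.disp_t) (X : finPOrderType d) (K : fieldType)
    (star : J X K -> J X K -> J X K) :
  proper_structure (@J_mul d X K) star <->
  bilinear_product star /\
  exists (sigma : strict_pair X -> K) (bul : J X K -> J X K -> J X K),
    [/\ constant_on_chains sigma,
        annihilator_valued_structure (@J_mul d X K) bul &
        forall x y u v : X, (x < y)%O -> (u < v)%O ->
          star (J_basis K x y) (J_basis K u v) =
            (ext0 sigma x v * (y == u)%:R) *: J_basis K x v
            + bul (J_basis K x y) (J_basis K u v)].
Proof.
split=> [[[bstar _ _] [phi [bul [cphi sbul starE]]]]|].
  split=> //; exists (fun p => centroid_coef phi (val p).1 (val p).2), bul.
  split=> //; first exact: centroid_coef_chain.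
  move=> x y u v xy uv; rewrite starE J_basisM //; congr (_ + _).
  have [yu|_] := eqVneq y u; last by rewrite mulr0 !scale0r linear0.
  rewrite -yu in uv; have xv := lt_trans xy uv.
  (* Here x < y < v, so phi acts on e_xv by a scalar. *)
  rewrite scale1r mulr1; have [-> _ _] := centroid_basis_mid cphi xy uv.
  pose p : strict_pair X := exist _ (x, v) xv.
  by rewrite -[x]/(val p).1 -[v]/(val p).2 ext0_strict.
move=> [bstar [sigma [bul [csigma sbul starE]]]].
have dotA := @J_mulA d X K; have bdot := @J_mul_bilinear d X K.
have cphi := diag_in_centroid csigma.
(* The product built from [sigma] on all of J; its bilinearity lets the comparison with [star] be
   made on basis pairs alone. *)
pose star' a b := diag_fun sigma (J_mul a b) + bul a b.
have [[bstar' _ _] _] : proper_structure (@J_mul d X K) star'.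
  exact: (proper_structure_centroid bdot dotA cphi sbul).
apply: (proper_structure_centroid bdot dotA cphi sbul).
apply: (eq_bilinear_J bstar bstar') => x y u v xy uv.
rewrite starE // /star' J_basisM // linearZ /=; congr (_ + _).
have [yu|_] := eqVneq y u; last by rewrite mulr0 !scale0r.
have xv : (x < v)%O by rewrite (lt_trans xy) // yu.
(* It remains to see that the diagonal map multiplies e_xv by its value at (x, v): all other
   coordinates are zero on both sides. *)
rewrite mulr1 scale1r; apply: JcoefP => s t.
rewrite JcoefZ Jcoef_diag Jcoef_basis //.
by case: eqP => [[-> ->] //|]; rewrite !mulr0.
Qed.
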